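(* For all positive integers $m$ and $n$, $$C(m,n)\;\ge\; n-\log_2\left(\sum_{j=0}^{\lfloor n/2\rfloor}\binom{n}{2j}\left(\frac{\binom{2j}{j}}{2^{2j}}\right)^m\right),$$ where $C(m,n)$ is the maximal sum capacity (in bits) of noiseless binary CDMA channels with $n$ users and spreading gain $m$.
   Context: Let $\mathcal M_{m\times n}(\pm1)$ be the set of $m\times n$ matrices with entries in $\{+1,-1\}$ (signature matrices). For $A\in\mathcal M_{m\times n}(\pm1)$ the noiseless binary CDMA channel has input $X=(X_1,\dots,X_n)^T$ with $X_i\in\{\pm1\}$ and output $Y=\frac{1}{\sqrt m}AX$. Its sum capacity is $C(A)=\max I(X;Y)$, where $I$ is mutual information in bits (logarithms to base 2) and the maximum is over all product distributions $p_1(x_1)p_2(x_2)\cdots p_n(x_n)$ of $X$ on $\{\pm1\}^n$ (i.e. $X_1,\dots,X_n$ independent). Finally $C(m,n)=\max_{A\in\mathcal M_{m\times n}(\pm1)}C(A)$. *)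

(* Defs.v *)
From mathcomp Require Import all_boot all_order all_algebra.
From mathcomp Require Import boolp classical_sets reals exp.

Set Implicit Arguments.
Unset Strict Implicit.
Unset Printing Implicit Defensive.

Import Order.TTheory GRing.Theory Num.Theory.
Local Open Scope classical_set_scope.
Local Open Scope ring_scope.

Definition log2 (R : realType) (x : R) : R := ln x / ln 2.

Definition is_pmf (R : realType) (T : finType) (p : T -> R) : Prop :=
  (forall t, 0 <= p t) /\ \sum_t p t = 1.

Definition Pr (R : realType) (W : finType) (P : W -> R) (E : pred W) : R :=
  \sum_(w | E w) P w.

(* Mutual information, in bits, of two random variables on the finite
   probability space (W, P).  The target types need not be finite: the sums
   range over the values actually taken.  Terms of joint probability 0 vanish,
   which is the usual convention for 0 log 0. *)
Definition mutual_info (R : realType) (W : finType) (P : W -> R)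
    (S T : eqType) (X : W -> S) (Y : W -> T) : R :=
  \sum_(x <- undup (codom X)) \sum_(y <- undup (codom Y))
    Pr P (fun w => (X w == x) && (Y w == y)) *
    log2 (Pr P (fun w => (X w == x) && (Y w == y)) /
          (Pr P (fun w => X w == x) * Pr P (fun w => Y w == y))).

Definition signature_mx (R : realType) (m n : nat) : set 'M[R]_(m, n) :=
  [set A | forall i j, A i j = 1 \/ A i j = -1].

(* The alphabet {+1, -1} is indexed by bool, b standing for (-1) ^+ b. *)
Definition cdma_input (R : realType) (n : nat)
    (w : {ffun 'I_n -> bool}) : 'cV[R]_n :=
  \col_i (-1) ^+ w i.

Definition cdma_output (R : realType) (m n : nat) (A : 'M[R]_(m, n))
    (w : {ffun 'I_n -> bool}) : 'cV[R]_m :=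
  (Num.sqrt m%:R)^-1 *: (A *m cdma_input R w).

Definition prod_pmf (R : realType) (n : nat) (p : 'I_n -> bool -> R)
    (w : {ffun 'I_n -> bool}) : R :=
  \prod_i p i (w i).

(* The two suprema below are maxima: mutual information is continuous in p on
   a compact set of product distributions, and there are finitely many
   signature matrices. *)
Definition sum_capacity (R : realType) (m n : nat) (A : 'M[R]_(m, n)) : R :=
  sup [set r : R | exists2 p : 'I_n -> bool -> R, (forall i, is_pmf (p i)) &
         r = mutual_info (prod_pmf p) (@cdma_input R n) (cdma_output A)].

Definition max_sum_capacity (R : realType) (m n : nat) : R :=
  sup [set sum_capacity A | A in @signature_mx R m n].

(* Main.v *)
Require Import Defs.
From mathcomp Require Import all_boot all_order all_algebra.
From mathcomp Require Import boolp classical_sets reals exp.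

(** Random coding.  Take the uniform product input and a uniformly random
    signature matrix [A].  Since [Y] is a function of [X], the mutual information
    is [n - E log2 N], where [N] is the number of inputs giving the same output
    as [X].  By concavity of the logarithm the average over [A] is at least
    [n - log2 E N], so some [A] does as well.  For a pair of inputs differing in
    [k] coordinates, the outputs agree iff for each of the [m] independent rows
    a sum of [k] random signs vanishes, which has probability
    ['C(k, k/2) / 2 ^ k] for even [k] and [0] for odd [k]; summing over the
    ['C(n, k)] choices of coordinates evaluates [E N]. *)

Set Implicit Arguments.
Unset Strict Implicit.
Unset Printing Implicit Defensive.

Import Order.TTheory GRing.Theory Num.Theory.
Local Open Scope ring_scope.

(** Jensen's inequality for [ln], from the tangent at the mean [M]: [ln x <= ln M + (x / M - 1)],
    and the linear corrections sum to zero. *)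
Lemma sum_ln_le (R : realType) (I : finType) (f : I -> R) (M : R) :
  0 < M -> (forall i, 0 < f i) -> \sum_i f i = #|I|%:R * M ->
  \sum_i ln (f i) <= #|I|%:R * ln M.
Proof.
move=> M0 f0 fM.
have -> : #|I|%:R * ln M = \sum_i (ln M + (f i / M - 1)).
  rewrite big_split sumrB -mulr_suml fM mulfK ?gt_eqF //=.
  by rewrite !sumr_const subrr addr0 mulr_natl.
apply: ler_sum => i _; rewrite -lerBlDl -ln_div ?posrE //.
rewrite -{1}(subrK 1 (f i / M)) addrC; apply: le_ln1Dx.
by rewrite ltrBrDl subrr divr_gt0.
Qed.

(** * Mutual information of an injective input, and boundedness *)

Lemma mutual_info_injective (R : realType) (W : finType) (P : W -> R)
    (S T : eqType) (X : W -> S) (Y : W -> T) :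
  injective X ->
  mutual_info P X Y =
    \sum_w P w * log2 (P w / (P w * Pr P (fun w' => Y w' == Y w))).
Proof.
move=> Xinj; rewrite /mutual_info undup_id ?map_inj_uniq -?enumT ?enum_uniq //.
rewrite big_image; apply: eq_bigr => w _ /=.
(* By injectivity the event [X = X w] is the single outcome [w], so only the output value [Y w] can
   contribute. *)
rewrite (bigD1_seq (Y w)) ?undup_uniq ?mem_undup ?codom_f //=.
have PX : Pr P (fun w' => X w' == X w) = P w.
  by rewrite /Pr (big_pred1 w) // => w'; rewrite (inj_eq Xinj).
rewrite PX big1 => [|y yY].
  rewrite addr0.
  have -> // : Pr P (fun w' => (X w' == X w) && (Y w' == Y w)) = P w.
  rewrite /Pr (big_pred1 w) // => w'; rewrite (inj_eq Xinj) /=.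
  by case: eqP => // ->; rewrite eqxx.
suff -> : Pr P (fun w' => (X w' == X w) && (Y w' == y)) = 0 by rewrite mul0r.
rewrite /Pr big_pred0 // => w'; rewrite (inj_eq Xinj).
by case: eqP => // ->; rewrite eq_sym (negPf yY).
Qed.

Lemma ln2_gt0 (R : realType) : 0 < ln 2 :> R.
Proof. by rewrite ln_gt0 // ltr1n. Qed.

(** A crude bound that makes the capacity suprema finite. With [q] the probability of the output at
    [w], [P w <= q] gives [ln (1 / q) <= 1 / q <= 1 / P w], so each outcome contributes at most
    [1 / ln 2]. *)
Lemma mutual_info_injective_le (R : realType) (W : finType) (P : W -> R)
    (S T : eqType) (X : W -> S) (Y : W -> T) :
  injective X -> (forall w, 0 <= P w) ->
  mutual_info P X Y <= #|W|%:R / ln 2.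
Proof.
move=> Xinj P0; rewrite mutual_info_injective // mulr_natl -sumr_const.
apply: ler_sum => w _; rewrite /log2 mulrA -[leRHS]mul1r.
rewrite ler_pM2r ?invr_gt0 ?ln2_gt0 //.
have := P0 w; rewrite le_eqVlt => /predU1P[<-|Pw]; first by rewrite mul0r.
have PwY : P w <= Pr P (fun w' => Y w' == Y w).
  by rewrite /Pr (bigD1 w) //= lerDl sumr_ge0.
have Y0 := lt_le_trans Pw PwY.
rewrite invfM mulrA divff ?gt_eqF // mul1r.
rewrite -(divff (lt0r_neq0 Pw)) ler_pM2l //.
apply: (@le_trans _ _ (Pr P (fun w' => Y w' == Y w))^-1).
  by apply/ltW/ln_sublinear; rewrite invr_gt0.
by rewrite lef_pV2 ?posrE.
Qed.

Lemma cdma_input_inj (R : realType) (n : nat) : injective (@cdma_input R n).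
Proof.
move=> w w' /matrixP e; apply/ffunP => i; have := e i 0; rewrite !mxE.
have : (-1 == 1 :> R) = false by apply: lt_eqF; rewrite (lt_trans (ltrN10 _)).
by case: (w i); case: (w' i) => //= h /eqP; rewrite ?expr0 ?expr1 ?h // eq_sym h.
Qed.

Lemma mutual_info_cdma_le (R : realType) (m n : nat) (A : 'M[R]_(m, n))
    (p : 'I_n -> bool -> R) :
  (forall i, is_pmf (p i)) ->
  mutual_info (prod_pmf p) (@cdma_input R n) (cdma_output A)
    <= (2 ^ n)%:R / ln 2.
Proof.
move=> pP; have -> : (2 ^ n)%N = #|{: {ffun 'I_n -> bool}}|.
  by rewrite card_ffun card_bool card_ord.
apply: mutual_info_injective_le; first exact: cdma_input_inj.
by move=> w; apply: prodr_ge0 => i _; case: (pP i).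
Qed.

Definition uniform_bit (R : realType) (n : nat) (i : 'I_n) (b : bool) : R := 2^-1.

Lemma uniform_bit_pmf (R : realType) (n : nat) (i : 'I_n) :
  is_pmf (uniform_bit R i).
Proof.
split=> [b|]; first by rewrite invr_ge0.
by rewrite sumr_const card_bool -[LHS]mulr_natl divff // pnatr_eq0.
Qed.

Lemma mutual_info_le_max_sum_capacity (R : realType) (m n : nat)
    (A : 'M[R]_(m, n)) (p : 'I_n -> bool -> R) :
  signature_mx A -> (forall i, is_pmf (p i)) ->
  mutual_info (prod_pmf p) (@cdma_input R n) (cdma_output A)
    <= max_sum_capacity R m n.
Proof.
move=> sA pP; apply: (@le_trans _ _ (sum_capacity A)).
  apply: sup_upper_bound; last by exists p.
  split; first by eexists; exists p.
  by exists ((2 ^ n)%:R / ln 2) => _ [q qP ->]; apply: mutual_info_cdma_le.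
apply: sup_upper_bound; last by exists A.
split; first by exists (sum_capacity A), A.
(* The bound is uniform in the matrix; the uniform input shows that each inner set is nonempty. *)
exists ((2 ^ n)%:R / ln 2) => _ [B sB <-]; apply: ge_sup.
  by eexists; exists (uniform_bit R (n := n)) => //; exact: uniform_bit_pmf.
by move=> _ [q qP ->]; apply: mutual_info_cdma_le.
Qed.

(** * Uniform input and the number of confusable inputs *)

Definition confusions (R : realType) (m n : nat) (A : 'M[R]_(m, n))
    (w : {ffun 'I_n -> bool}) : nat :=
  #|[set w' | cdma_output A w' == cdma_output A w]|.

Lemma confusions_gt0 (R : realType) (m n : nat) (A : 'M[R]_(m, n)) w :
  (0 < confusions A w)%N.
Proof. by apply/card_gt0P; exists w; rewrite inE. Qed.

Lemma mutual_info_uniform (R : realType) (m n : nat) (A : 'M[R]_(m, n)) :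
  mutual_info (prod_pmf (uniform_bit R (n := n))) (@cdma_input R n)
      (cdma_output A) =
    n%:R - 2 ^- n * \sum_w log2 (confusions A w)%:R.
Proof.
rewrite mutual_info_injective; last exact: cdma_input_inj.
have Pu w : prod_pmf (uniform_bit R (n := n)) w = 2 ^- n.
  by rewrite /prod_pmf /uniform_bit prodr_const card_ord exprVn.
have n0 : 2 ^+ n != 0 :> R by rewrite expf_neq0 // pnatr_eq0.
transitivity (\sum_(w : {ffun 'I_n -> bool})
    2 ^- n * (n%:R - log2 (confusions A w)%:R : R)).
  apply: eq_bigr => w _; rewrite Pu; congr (_ * _).
  have -> : Pr (prod_pmf (uniform_bit R (n := n)))
      (fun w' => cdma_output A w' == cdma_output A w) =
      (confusions A w)%:R / 2 ^+ n.
    rewrite /Pr (eq_bigr (fun=> 2 ^- n)) // mulr_natl -sumr_const.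
    by apply: eq_bigl => w'; rewrite inE.
  rewrite invfM mulrA divff ?invr_eq0 // mul1r.
  rewrite invf_div /log2 ln_div ?posrE ?exprn_gt0 //; last first.
    by rewrite ltr0n confusions_gt0.
  by rewrite lnXn // mulrBl -[ln 2 *+ n]mulr_natl mulfK // gt_eqF ?ln2_gt0.
rewrite -mulr_sumr sumrB mulrBr sumr_const card_ffun card_ord card_bool.
by rewrite -[n%:R *+ _]mulr_natl natrX mulKf.
Qed.

(** * Counting sign vectors balanced on a coordinate set *)

Definition diff (n : nat) (w b : {ffun 'I_n -> bool}) : {set 'I_n} :=
  [set i | b i (+) w i].

(** For fixed [w], [diff w] is a bijection onto subsets, inverted by xor with [w]. *)
Lemma big_diff (T : Type) (idx : T) (op : Monoid.com_law idx) (n : nat)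
    (w : {ffun 'I_n -> bool}) (P : pred {set 'I_n}) (F : {set 'I_n} -> T) :
  \big[op/idx]_(b | P (diff w b)) F (diff w b) = \big[op/idx]_(S | P S) F S.
Proof.
symmetry; apply: reindex; apply: onW_bij.
exists (fun S : {set 'I_n} => [ffun i => (i \in S) (+) w i]) => [b|S].
  by apply/ffunP => i; rewrite ffunE inE addbK.
by apply/setP => i; rewrite inE ffunE addbK.
Qed.

Lemma sum_sign_set (R : pzRingType) (I : finType) (D S : {set I}) :
  \sum_(i in D) (-1) ^+ (i \in S) = #|D|%:R - (2 * #|S :&: D|)%:R :> R.
Proof.
rewrite -sum1_card -sum1_card mulnC big_distrl /= !natr_sum big_mkcond /=.
rewrite [X in X - _]big_mkcond [X in _ - X]big_mkcond -sumrB.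
apply: eq_bigr => i _; rewrite inE; case: (i \in D); rewrite ?andbF ?subr0 //.
case: (i \in S) => /=; last by rewrite subr0.
by rewrite expr1 mul1n (natrD _ 1 1) opprD addrA subrr sub0r.
Qed.

(** Coordinates where [w] and [w'] agree cancel, and the others flip sign. The difference is thus
    twice the sum of the signs [b i * w i] over [diff w w'], up to sign; [diff w b] marks the
    negative ones, which must make up exactly half. *)
Lemma sign_sum_eq (R : numDomainType) (n : nat) (b w w' : {ffun 'I_n -> bool}) :
  (\sum_i (-1) ^+ b i * (-1) ^+ w' i == \sum_i (-1) ^+ b i * (-1) ^+ w i :> R) =
  (#|diff w w'| == 2 * #|diff w b :&: diff w w'|)%N.
Proof.
rewrite -subr_eq0 -sumrB.
have -> : \sum_i ((-1) ^+ b i * (-1) ^+ w' i - (-1) ^+ b i * (-1) ^+ w i) =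
    - (2 * \sum_(i in diff w w') (-1) ^+ (i \in diff w b)) :> R.
  rewrite mulr_sumr -sumrN [RHS]big_mkcond; apply: eq_bigr => i _.
  rewrite !inE mulr_natl mulr2n.
  case: (b i); case: (w i); case: (w' i) => /=;
    by rewrite ?expr0 ?expr1 ?mulrNN ?mulr1 ?mul1r ?opprK ?opprD ?opprK ?subrr
               ?addNr.
by rewrite oppr_eq0 mulf_eq0 pnatr_eq0 /= sum_sign_set subr_eq0 eqr_nat.
Qed.

(** For [k <= n], this is [2 ^ n] times the probability that [k] random signs sum to zero. *)
Definition balanced_count (n k : nat) : nat :=
  if odd k then 0%N else ('C(k, k./2) * 2 ^ (n - k))%N.

(** Such an [S] is [T] together with an arbitrary subset of the complement of [D]. *)
Lemma card_setI_eq (I : finType) (D T : {set I}) :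
  T \subset D -> #|[set S : {set I} | S :&: D == T]| = (2 ^ (#|I| - #|D|))%N.
Proof.
move=> TD; rewrite -(cardsC D) addKn -card_powerset.
rewrite -(@card_in_imset _ _ (fun S => T :|: S) (powerset (~: D))).
  apply: eq_card => S; rewrite inE; apply/eqP/imsetP => [<-|[U]].
    exists (S :\: D); first by rewrite inE finset.setDE finset.subsetIr.
    by rewrite finset.setID.
  rewrite inE => UD ->; rewrite finset.setIUl (finset.setIidPl TD).
  suff -> : U :&: D = finset.set0 by rewrite finset.setU0.
  by apply: finset.disjoint_setI0; rewrite finset.disjoints_subset.
move=> U V; rewrite !inE => UD VD /setP TUV; apply/setP => i.
have := TUV i; rewrite !inE; case: (boolP (i \in T)) => //= iT _.
have iD := fintype.subsetP TD _ iT.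
have notin (A : {set I}) : A \subset ~: D -> (i \in A) = false.
  by move=> /fintype.subsetP/(_ i) Ai; apply/negP => /Ai; rewrite inE iD.
by rewrite !notin.
Qed.

Lemma card_balanced (n : nat) (D : {set 'I_n}) :
  #|[set S : {set 'I_n} | #|D| == 2 * #|S :&: D|]%N| = balanced_count n #|D|.
Proof.
rewrite /balanced_count; case: ifPn => [oD|eD].
  apply: eq_card0 => S; rewrite inE; apply: contraTF oD => /eqP ->.
  by rewrite mul2n odd_double.
rewrite -cards_draws -sum_nat_const -sum1dep_card.
(* Sort the sets by their trace on [D], a half-size subset of [D]. *)
rewrite (partition_big (fun S => S :&: D)
  (mem [set T : {set 'I_n} | T \subset D & #|T| == #|D|./2])) /=.
  apply: eq_bigr => T; rewrite inE => /andP[TD /eqP cT].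
  have := card_setI_eq TD; rewrite card_ord sum1dep_card => <-.
  apply: eq_card => S; rewrite !inE; case: (_ =P T) => [->|]; rewrite ?andbF //.
  by rewrite andbT cT mul2n even_halfK ?eqxx.
by move=> S /eqP ->; rewrite inE finset.subsetIr mul2n doubleK eqxx.
Qed.

Lemma sum_balanced_count (n m : nat) : (0 < m)%N ->
  (\sum_(D : {set 'I_n}) balanced_count n #|D| ^ m =
   \sum_(j < (n %/ 2).+1)
      'C(n, 2 * j) * ('C(2 * j, j) * 2 ^ (n - 2 * j)) ^ m)%N.
Proof.
(* Odd sizes contribute [0 ^ m], which vanishes because [0 < m]. *)
move=> m0; rewrite (bigID (fun D : {set 'I_n} => odd #|D|)) /= big1 ?add0n.
  rewrite (partition_big (fun D : {set 'I_n} => inord #|D|./2 : 'I_(n %/ 2).+1)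
    xpredT) //=.
  apply: eq_bigr => j _.
  rewrite -[n in 'C(n, _)]card_ord -card_draws -sum_nat_const.
  have cD (D : {set 'I_n}) :
      (~~ odd #|D| && (inord #|D|./2 == j)) = (#|D| == 2 * j)%N.
    have lt : (#|D|./2 < (n %/ 2).+1)%N.
      by rewrite ltnS divn2 half_leq // -[n in (_ <= n)%N]card_ord max_card.
    rewrite -val_eqE /= inordK // mul2n; apply/andP/eqP => [[eD /eqP <-]|->].
      by rewrite even_halfK.
    by rewrite odd_double doubleK.
  apply: eq_big => [D|D]; first by rewrite inE cD.
  rewrite cD => /eqP ->; rewrite /balanced_count mul2n odd_double /=.
  by rewrite doubleK.
by move=> D oD; rewrite /balanced_count oD exp0n.
Qed.

(** * Averaging over random signature matrices *)

Definition sign_mx (R : realType) (m n : nat)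
    (B : {ffun 'I_m -> {ffun 'I_n -> bool}}) : 'M[R]_(m, n) :=
  \matrix_(i, j) (-1) ^+ B i j.

Lemma sign_mx_signature (R : realType) (m n : nat) B :
  signature_mx (@sign_mx R m n B).
Proof.
by move=> i j; rewrite mxE; case: (B i j); [right; rewrite expr1|left].
Qed.

Lemma cdma_output_sign_mx_eq (R : realType) (m n : nat)
    (B : {ffun 'I_m -> {ffun 'I_n -> bool}}) w w' : (0 < m)%N ->
  (cdma_output (sign_mx R B) w' == cdma_output (sign_mx R B) w) =
  [forall i, (#|diff w w'| == 2 * #|diff w (B i) :&: diff w w'|)%N].
Proof.
(* Positivity of [m] makes the normalising factor nonzero, so scaling is injective. *)
move=> m0; rewrite /cdma_output (inj_eq (scalerI _)); last first.
  by rewrite invr_eq0 sqrtr_eq0 -ltNge ltr0n.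
have rowE v i : (sign_mx R B *m cdma_input R v) i 0 =
    \sum_j (-1) ^+ B i j * (-1) ^+ v j.
  by rewrite mxE; apply: eq_bigr => j _; rewrite !mxE.
apply/eqP/forallP => [/matrixP e i|e].
  by rewrite -(@sign_sum_eq R) -!rowE e.
apply/matrixP => i j; rewrite ord1 !rowE; apply/eqP.
by rewrite sign_sum_eq.
Qed.

Lemma sum_confusions (R : realType) (m n : nat) : (0 < m)%N ->
  (\sum_(B : {ffun 'I_m -> {ffun 'I_n -> bool}}) \sum_w
     confusions (sign_mx R B) w =
   2 ^ n * \sum_(D : {set 'I_n}) balanced_count n #|D| ^ m)%N.
Proof.
move=> m0; rewrite exchange_big /=.
have -> : (2 ^ n)%N = #|{: {ffun 'I_n -> bool}}|.
  by rewrite card_ffun card_bool card_ord.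
rewrite -sum_nat_const.
apply: eq_bigr => w _.
rewrite -(big_diff _ w xpredT) /=.
under eq_bigr do rewrite /confusions -sum1dep_card big_mkcond /=.
rewrite exchange_big /=; apply: eq_bigr => w' _.
rewrite -big_mkcond /= -card_balanced.
rewrite -[X in (X ^ _)%N]sum1dep_card -(big_diff _ w).
(* The rows are chosen independently among the balanced ones, hence the power [m]. *)
rewrite !sum1dep_card -[m in RHS]card_ord -card_ffun_on.
apply: eq_card => B; rewrite inE cdma_output_sign_mx_eq //.
apply/forallP/ffun_onP => h i; first by rewrite inE.
by have := h i; rewrite inE.
Qed.

Theorem theorem1 (R : realType) (m n : nat) (hm : (0 < m)%N) (hn : (0 < n)%N) :
  max_sum_capacity R m n >=
    n%:R - log2 (\sum_(j < (n %/ 2).+1)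
      'C(n, 2 * j)%:R * ('C(2 * j, j)%:R / 2 ^+ (2 * j)) ^+ m).
Proof.
set M := \sum_(j < _) _.
pose BT : finType := {ffun 'I_m -> {ffun 'I_n -> bool}}.
pose WT : finType := {ffun 'I_n -> bool}.
have cW : #|WT| = (2 ^ n)%N by rewrite card_ffun card_bool card_ord.
have cB : #|BT| = ((2 ^ n) ^ m)%N by rewrite card_ffun cW card_ord.
have B0 : 0 < #|BT|%:R :> R by rewrite cB ltr0n !expn_gt0.
(* The term [j = 0] equals 1. *)
have M0 : 0 < M.
  rewrite /M big_ord_recl /= muln0 !bin0 expr0 divr1 expr1n mulr1.
  rewrite ltr_wpDr // sumr_ge0 // => j _.
  by rewrite mulr_ge0 ?exprn_ge0 ?divr_ge0 ?exprn_ge0.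
(* [M] is the mean of the confusion count over all pairs of a matrix and an input. *)
have sumN : \sum_(p : BT * WT) (confusions (sign_mx R p.1) p.2)%:R =
    #|{: BT * WT}|%:R * M :> R.
  rewrite -(pair_bigA _ (fun B w => (confusions (sign_mx R B) w)%:R)) /=.
  under eq_bigr do rewrite -natr_sum.
  rewrite -natr_sum sum_confusions // sum_balanced_count // card_prod cB cW.
  rewrite natrM [in RHS]natrM.
  suff -> : (\sum_(j < (n %/ 2).+1) 'C(n, 2 * j) *
      ('C(2 * j, j) * 2 ^ (n - 2 * j)) ^ m)%:R = ((2 ^ n) ^ m)%:R * M :> R.
    by rewrite mulrCA mulrA.
  rewrite natr_sum mulr_sumr; apply: eq_bigr => j _.
  have jn : (2 * j <= n)%N.
    by rewrite mulnC -leq_divRL // -ltnS ltn_ord.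
  rewrite natrM mulrCA; congr (_ * _).
  rewrite !(natrX, natrM) -exprMn mulrCA; congr ((_ * _) ^+ m).
  have e0 : 2 ^+ (2 * j) != 0 :> R by rewrite expf_neq0 // pnatr_eq0.
  by apply: (mulIf e0); rewrite divfK // -exprD subnK.
have N0 (p : BT * WT) : 0 < (confusions (sign_mx R p.1) p.2)%:R :> R.
  by rewrite ltr0n confusions_gt0.
have avg := sum_ln_le M0 N0 sumN.
have lb (B : BT) : n%:R - 2 ^- n * \sum_w log2 (confusions (sign_mx R B) w)%:R
    <= max_sum_capacity R m n.
  rewrite -mutual_info_uniform; apply: mutual_info_le_max_sum_capacity.
    exact: sign_mx_signature.
  exact: uniform_bit_pmf.
(* Instead of selecting a good matrix, sum [lb] over all matrices: the capacity dominates each term,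
   hence the average. *)
rewrite -(ler_pM2l B0).
apply: (@le_trans _ _ (\sum_(B : BT) (n%:R -
    2 ^- n * \sum_w log2 (confusions (sign_mx R B) w)%:R))); last first.
  by rewrite mulr_natl -sumr_const; apply: ler_sum => B _.
rewrite sumrB sumr_const -[n%:R *+ _]mulr_natl mulrBr lerD2l lerN2 -mulr_sumr.
rewrite ler_pdivrMl ?exprn_gt0 // (pair_bigA _ (fun B w => log2 _)) /=.
rewrite -mulr_suml mulrA mulrA ler_pM2r ?invr_gt0 ?ln2_gt0 //.
by move: avg; rewrite card_prod natrM cW natrX [_%:R * 2 ^+ n]mulrC.
Qed.
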